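(* Minimal translation surfaces of type 3 in the Heisenberg group $\mathrm{Nil}_3$ are parameterized by $$r(x,y)=(0,x,u(x))*(y,v(y),0)=\Big(y,\,x+v(y),\,u(x)-\frac{xy}{2}\Big),$$ where (i) either $u(x)=\frac{a}{2(1+a^2)}\,x^2+bx+c$ and $v(y)=-ay+d$, with $a,b,c,d\in\mathbb{R}$, (ii) or $u(x)=ax+u_0$ and $$v(y)=\frac{b}{2a-y}+\frac{c}{2(2a-y)}\left[(a-y)\sqrt{1+(a-y)^2}+\ln\left(a-y+\sqrt{1+(a-y)^2}\right)\right],$$ with $a,b,c,u_0\in\mathbb{R}$.
   Context: The Heisenberg group $\mathrm{Nil}_3$ is $\mathbb{R}^3$ with the group operation $$(x,y,z)*(\overline{x},\overline{y},\overline{z})=\Big(x+\overline{x},\ y+\overline{y},\ z+\overline{z}+\frac{x\overline{y}}{2}-\frac{\overline{x}y}{2}\Big),$$ equipped with the left invariant Riemannian metric $$\tilde g=dx^2+dy^2+\Big(dz+\tfrac12(y\,dx-x\,dy)\Big)^2.$$ A translation surface $M(\gamma_1,\gamma_2)$ in $\mathrm{Nil}_3$ is a surface parametrized by $r(x,y)=\gamma_1(x)*\gamma_2(y)$, where $\gamma_1,\gamma_2$ are curves lying in coordinate planes of $\mathbb{R}^3$. It is of type 3 when $\gamma_1(x)=(0,x,u(x))$ and $\gamma_2(y)=(y,v(y),0)$, with $u,v$ smooth functions of one variable. A surface immersed in $(\mathrm{Nil}_3,\tilde g)$ is minimal if its mean curvature $H=\frac12\mathrm{trace}(A)$ vanishes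 identically, where $A$ is the shape operator associated to a unit normal.
   Formalization: Every minimal surface is shown to have form (i) or (ii), and all surfaces (ii) are shown minimal; for (i) the converse is stated only for d = 0, since surfaces (i) with d ≠ 0 are not minimal (e.g. u(x) = x, v(y) = 1). *)

(* Defs.v *)
From Stdlib Require Export Reals Lra.
From Coquelicot Require Export Coquelicot.
Open Scope R_scope.

(** * Linear algebra in R^3 *)

Definition R3 : Type := (R * R * R)%type.

Inductive axis : Set := ax1 | ax2 | ax3.

Definition coord (i : axis) (p : R3) : R :=
  let '(x, y, z) := p in
  match i with ax1 => x | ax2 => y | ax3 => z end.

Definition of_coords (f : axis -> R) : R3 := (f ax1, f ax2, f ax3).

Definition sum3 (f : axis -> R) : R := f ax1 + f ax2 + f ax3.

Definition basis (i : axis) : R3 :=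
  match i with ax1 => (1, 0, 0) | ax2 => (0, 1, 0) | ax3 => (0, 0, 1) end.

Definition next (i : axis) : axis :=
  match i with ax1 => ax2 | ax2 => ax3 | ax3 => ax1 end.

Definition det3 (M : axis -> axis -> R) : R :=
  sum3 (fun i => M ax1 i * (M ax2 (next i) * M ax3 (next (next i))
                            - M ax2 (next (next i)) * M ax3 (next i))).

(** The adjugate divided by the determinant: taking the indices cyclically
    absorbs the signs of the cofactors. *)
Definition inv3 (M : axis -> axis -> R) (i j : axis) : R :=
  (M (next j) (next i) * M (next (next j)) (next (next i))
   - M (next j) (next (next i)) * M (next (next j)) (next i)) / det3 M.

Lemma inv3_correct (M : axis -> axis -> R) (i j : axis) :
  det3 M <> 0 ->
  sum3 (fun k => M i k * inv3 M k j)
  = match i, j with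
    | ax1, ax1 | ax2, ax2 | ax3, ax3 => 1
    | _, _ => 0
    end.
Proof.
  unfold inv3, det3, sum3; destruct i, j; simpl; intros H; field; exact H.
Qed.

(** * Riemannian metrics on R^3 and their Levi-Civita connection

    A metric [g] is given by the bilinear forms [g p] on the tangent spaces,
    tangent vectors being written in the coordinate basis. *)

Definition partial (i : axis) (f : R3 -> R) (p : R3) : R :=
  let '(x, y, z) := p in
  match i with
  | ax1 => Derive (fun t => f (t, y, z)) x
  | ax2 => Derive (fun t => f (x, t, z)) y
  | ax3 => Derive (fun t => f (x, y, t)) z
  end.

Definition gram (g : R3 -> R3 -> R3 -> R) (i j : axis) (p : R3) : R :=
  g p (basis i) (basis j).

(** [christoffel g k i j p] is the symbol with upper index [k]. *)
Definition christoffel (g : R3 -> R3 -> R3 -> R) (k i j : axis) (p : R3) : R :=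
  / 2 * sum3 (fun l => inv3 (fun m n => gram g m n p) k l *
                       (partial i (gram g j l) p + partial j (gram g i l) p
                        - partial l (gram g i j) p)).

(** * Parametrized surfaces in (R^3, g) *)

Definition d1 (r : R -> R -> R3) (x y : R) : R3 :=
  of_coords (fun k => Derive (fun t => coord k (r t y)) x).

Definition d2 (r : R -> R -> R3) (x y : R) : R3 :=
  of_coords (fun k => Derive (fun t => coord k (r x t)) y).

(** Covariant derivatives, along the coordinate directions of the surface [r],
    of a vector field [N] along [r]. *)
Definition cov1 (g : R3 -> R3 -> R3 -> R) (r N : R -> R -> R3) (x y : R) : R3 :=
  of_coords (fun k =>
    coord k (d1 N x y)
    + sum3 (fun i => sum3 (fun j =>
        christoffel g k i j (r x y) * coord i (d1 r x y) * coord j (N x y)))).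

Definition cov2 (g : R3 -> R3 -> R3 -> R) (r N : R -> R -> R3) (x y : R) : R3 :=
  of_coords (fun k =>
    coord k (d2 N x y)
    + sum3 (fun i => sum3 (fun j =>
        christoffel g k i j (r x y) * coord i (d2 r x y) * coord j (N x y)))).

Definition immersed_at (r : R -> R -> R3) (x y : R) : Prop :=
  forall s t : R,
    (forall k, s * coord k (d1 r x y) + t * coord k (d2 r x y) = 0) ->
    s = 0 /\ t = 0.

Definition unit_normal_at (g : R3 -> R3 -> R3 -> R) (r N : R -> R -> R3)
    (x y : R) : Prop :=
  g (r x y) (N x y) (d1 r x y) = 0 /\
  g (r x y) (N x y) (d2 r x y) = 0 /\
  g (r x y) (N x y) (N x y) = 1.

(** The matrix [a11 a12; a21 a22], in the basis [d1 r, d2 r] of the tangent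
    plane, represents the shape operator X |-> - nabla_X N. *)
Definition is_shape_operator (g : R3 -> R3 -> R3 -> R) (r N : R -> R -> R3)
    (x y a11 a12 a21 a22 : R) : Prop :=
  forall k,
    - coord k (cov1 g r N x y)
      = a11 * coord k (d1 r x y) + a21 * coord k (d2 r x y) /\
    - coord k (cov2 g r N x y)
      = a12 * coord k (d1 r x y) + a22 * coord k (d2 r x y).

Definition is_mean_curvature (g : R3 -> R3 -> R3 -> R) (r N : R -> R -> R3)
    (x y H : R) : Prop :=
  exists a11 a12 a21 a22 : R,
    is_shape_operator g r N x y a11 a12 a21 a22 /\ H = / 2 * (a11 + a22).

(** * Surfaces over a product of two open intervals, possibly unbounded *)

Definition in_itv (a b : Rbar) (x : R) : Prop := Rbar_lt a x /\ Rbar_lt x b.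

Definition smooth_on (a b : Rbar) (f : R -> R) : Prop :=
  forall (n : nat) (x : R), in_itv a b x -> ex_derive_n f n x.

(** Such a parameter domain is connected, so a differentiable unit normal along
    an immersed surface is unique up to sign and minimality does not depend on
    its choice. *)
Definition minimal (g : R3 -> R3 -> R3 -> R) (r : R -> R -> R3)
    (xl xr yl yr : Rbar) : Prop :=
  (forall x y, in_itv xl xr x -> in_itv yl yr y -> immersed_at r x y) /\
  exists N : R -> R -> R3,
    forall x y, in_itv xl xr x -> in_itv yl yr y ->
      (forall k, differentiable_pt (fun s t => coord k (N s t)) x y) /\
      unit_normal_at g r N x y /\
      is_mean_curvature g r N x y 0.

(** * The Heisenberg group *)

Definition nil_mul (p q : R3) : R3 :=
  let '(x, y, z) := p in
  let '(x', y', z') := q in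
  (x + x', y + y', z + z' + x * y' / 2 - x' * y / 2).

(** The left invariant 1-form dz + (y dx - x dy) / 2. *)
Definition nil_form (p V : R3) : R :=
  coord ax3 V + / 2 * (coord ax2 p * coord ax1 V - coord ax1 p * coord ax2 V).

Definition nil_metric (p V W : R3) : R :=
  coord ax1 V * coord ax1 W + coord ax2 V * coord ax2 W
  + nil_form p V * nil_form p W.

Definition translation_surface (gamma1 gamma2 : R -> R3) (x y : R) : R3 :=
  nil_mul (gamma1 x) (gamma2 y).

Definition type3_surface (u v : R -> R) : R -> R -> R3 :=
  translation_surface (fun x => (0, x, u x)) (fun y => (y, v y, 0)).

(* Main.v *)
(** In the left invariant orthonormal frame the coordinate vectors of the surface
    are (0, 1, p) and (1, v', q) with p = u' - y and q = (v - y v') / 2, a normal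
    is (p v' - q, - p, 1), and minimality reduces to
      (1 + p^2) (p + y/2) v'' - p q - v' - (1 + v'^2 + q^2) u'' = 0.
    If u' is constant, this is a linear equation in v that can be integrated. If
    not, u' takes all values of an interval while u'' does not depend on y: the
    cubic polynomials in u' obtained by solving for u'' at two values of y agree,
    and comparing coefficients gives v'' = 0 and q = 0. *)

Require Import Defs.
From Stdlib Require Import Classical Ranalysis5.

(** Minimality asserts only that some differentiable unit normal exists, so the differential
    equation has to be derived for an arbitrary normal [N]: orthogonality to the surface and unit
    length are differentiated along it, and this determines the derivatives of [N] that enter the
    trace. A normal is constructed only for the converse, by dividing [(p v' - q, - p, 1)] by its
    length. In the first family [q = 0] forces [d = 0]: if [v = - a y + d], then [q = d / 2], and
    the term [- p q] would depend on [y] while the rest of the equation does not. Hence the converse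
    concerns [v = - a y]. In the second family [2 a] may lie in the parameter interval, so the
    formula for [v] is read away from that point, and the converse recovers the equation there by
    continuity. *)

(** * Christoffel symbols of the Heisenberg metric *)

Definition nil_gamma (k i j : axis) (x y : R) : R :=
  match i, j with
  | ax1, ax1 => match k with ax1 => 0 | ax2 => - y / 2 | ax3 => - x * y / 4 end
  | ax1, ax2 | ax2, ax1 =>
      match k with ax1 => y / 4 | ax2 => x / 4 | ax3 => (x ^ 2 - y ^ 2) / 8 end
  | ax2, ax2 => match k with ax1 => - x / 2 | ax2 => 0 | ax3 => x * y / 4 end
  | ax1, ax3 | ax3, ax1 =>
      match k with ax1 => 0 | ax2 => - / 2 | ax3 => - x / 4 end
  | ax2, ax3 | ax3, ax2 =>
      match k with ax1 => / 2 | ax2 => 0 | ax3 => - y / 4 end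
  | ax3, ax3 => 0
  end.

Definition nil_gram (i j : axis) (x y : R) : R :=
  match i, j with
  | ax1, ax1 => 1 + y ^ 2 / 4
  | ax2, ax2 => 1 + x ^ 2 / 4
  | ax3, ax3 => 1
  | ax1, ax2 | ax2, ax1 => - x * y / 4
  | ax1, ax3 | ax3, ax1 => y / 2
  | ax2, ax3 | ax3, ax2 => - x / 2
  end.

Lemma gram_nil_metric (i j : axis) (x y z : R) :
  gram nil_metric i j (x, y, z) = nil_gram i j x y.
Proof.
  destruct i, j; unfold gram, nil_metric, nil_form; simpl; field.
Qed.

Definition nil_partial_gram (l i j : axis) (x y : R) : R :=
  match l, i, j with
  | ax1, ax2, ax2 => x / 2
  | ax1, ax1, ax2 | ax1, ax2, ax1 => - y / 4
  | ax1, ax2, ax3 | ax1, ax3, ax2 => - / 2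
  | ax2, ax1, ax1 => y / 2
  | ax2, ax1, ax2 | ax2, ax2, ax1 => - x / 4
  | ax2, ax1, ax3 | ax2, ax3, ax1 => / 2
  | _, _, _ => 0
  end.

Lemma partial_gram_nil_metric (l i j : axis) (x y z : R) :
  partial l (gram nil_metric i j) (x, y, z) = nil_partial_gram l i j x y.
Proof.
  destruct l; unfold partial;
    rewrite (Derive_ext _ _ _ (fun t => gram_nil_metric i j _ _ _));
    apply is_derive_unique; destruct i, j; simpl;
    auto_derive; trivial; field.
Qed.

Lemma christoffel_nil_metric (k i j : axis) (x y z : R) :
  christoffel nil_metric k i j (x, y, z) = nil_gamma k i j x y.
Proof.
  unfold christoffel, sum3.
  rewrite !partial_gram_nil_metric.
  unfold inv3, det3, sum3.
  rewrite !gram_nil_metric.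
  (* The side condition comes from the Gram determinant, which equals 1 because the left invariant
     coframe is unimodular. *)
  destruct k, i, j; simpl; field; nra.
Qed.

(** * Derivatives on open intervals *)

Lemma in_itv_locally (a b : Rbar) (x : R) :
  in_itv a b x -> locally x (in_itv a b).
Proof.
  intros [Ha Hb].
  exact (filter_and _ _ (open_Rbar_gt a x Ha) (open_Rbar_lt b x Hb)).
Qed.

Lemma in_itv_between (a b : Rbar) (s t x : R) :
  in_itv a b s -> in_itv a b t -> s <= x <= t -> in_itv a b x.
Proof.
  destruct a, b; unfold in_itv; simpl; intuition lra.
Qed.

Lemma in_itv_nonempty (a b : Rbar) : Rbar_lt a b -> exists x, in_itv a b x.
Proof.
  destruct a as [a | |], b as [b | |]; simpl; try contradiction; intros H.
  - exists ((a + b) / 2); split; simpl; lra.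
  - exists (a + 1); split; simpl; trivial; lra.
  - exists (b - 1); split; simpl; trivial; lra.
  - exists 0; split; exact I.
Qed.

Lemma in_itv_other (a b : Rbar) (x : R) :
  in_itv a b x -> exists t, in_itv a b t /\ t <> x.
Proof.
  intros Hx.
  destruct (in_itv_locally _ _ _ Hx) as [e He].
  assert (He0 := cond_pos e).
  exists (x + e / 2); split; [ | lra].
  apply He; unfold ball; simpl; unfold AbsRing_ball, abs, minus, plus, opp; simpl.
  rewrite Rabs_pos_eq; lra.
Qed.

Lemma is_derive_in_itv_ext (a b : Rbar) (f g : R -> R) (x l : R) :
  (forall t, in_itv a b t -> f t = g t) -> in_itv a b x ->
  is_derive f x l -> is_derive g x l.
Proof.
  intros H Hx; apply is_derive_ext_loc.
  exact (filter_imp _ _ H (in_itv_locally _ _ _ Hx)).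
Qed.

Lemma Derive_in_itv_ext (a b : Rbar) (f g : R -> R) (x l : R) :
  (forall t, in_itv a b t -> f t = g t) -> in_itv a b x ->
  is_derive g x l -> Derive f x = l.
Proof.
  intros H Hx Hl; apply is_derive_unique.
  apply (is_derive_in_itv_ext a b g); trivial.
  intros t Ht; symmetry; exact (H t Ht).
Qed.

Lemma is_derive_in_itv_zero (a b : Rbar) (f : R -> R) (c x l : R) :
  (forall t, in_itv a b t -> f t = c) -> in_itv a b x ->
  is_derive f x l -> l = 0.
Proof.
  intros H Hx Hl.
  apply (is_derive_in_itv_ext _ _ _ (fun _ => c) _ _ H Hx) in Hl.
  apply is_derive_unique in Hl.
  now rewrite Derive_const in Hl.
Qed.

(** Consequence of the mean value theorem; it supplies every constant of integration in the
    classification. *)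
Lemma is_derive_zero_const (a b : Rbar) (f : R -> R) :
  (forall t, in_itv a b t -> is_derive f t 0) ->
  exists c, forall t, in_itv a b t -> f t = c.
Proof.
  intros H.
  destruct (classic (exists t, in_itv a b t)) as [[t0 H0] | H0].
  (* On an empty interval any constant will do. *)
  2: exists 0; intros t Ht; case H0; now exists t.
  exists (f t0); intros t Ht.
  assert (B : forall s, Rmin t0 t <= s <= Rmax t0 t -> in_itv a b s).
  { unfold Rmin, Rmax; destruct (Rle_dec t0 t); intros s Hs.
    - exact (in_itv_between _ _ _ _ _ H0 Ht Hs).
    - exact (in_itv_between _ _ _ _ _ Ht H0 Hs). }
  destruct (MVT_gen f t0 t (fun _ => 0)) as [c [_ Hc]].
  - intros s Hs; apply H, B; lra.
  - intros s Hs; apply derivable_continuous_pt.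
    exists 0; apply is_derive_Reals, H, B, Hs.
  - lra.
Qed.

Lemma smooth_on_is_derive (a b : Rbar) (f : R -> R) (x : R) :
  smooth_on a b f -> in_itv a b x -> is_derive f x (Derive f x).
Proof. intros H Hx; exact (Derive_correct _ _ (H 1%nat x Hx)). Qed.

Lemma smooth_on_is_derive2 (a b : Rbar) (f : R -> R) (x : R) :
  smooth_on a b f -> in_itv a b x ->
  is_derive (Derive f) x (Derive (Derive f) x).
Proof. intros H Hx; exact (Derive_correct _ _ (H 2%nat x Hx)). Qed.

(** * Differentiability in two variables *)

Lemma differentiable_pt_plus (f g : R -> R -> R) (x y : R) :
  differentiable_pt f x y -> differentiable_pt g x y ->
  differentiable_pt (fun s t => f s t + g s t) x y.
Proof.
  intros [fx [fy Hf]] [gx [gy Hg]].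
  eexists; eexists.
  refine (differentiable_pt_lim_comp Rplus f g x y 1 1 _ _ _ _ _ Hf Hg).
  apply filterdiff_differentiable_pt_lim.
  refine (filterdiff_ext_lin _ _ _ (filterdiff_plus _) _).
  intros [s t]; unfold plus; simpl; ring.
Qed.

Lemma differentiable_pt_mult (f g : R -> R -> R) (x y : R) :
  differentiable_pt f x y -> differentiable_pt g x y ->
  differentiable_pt (fun s t => f s t * g s t) x y.
Proof.
  intros [fx [fy Hf]] [gx [gy Hg]].
  eexists; eexists.
  refine (differentiable_pt_lim_comp Rmult f g x y (g x y) (f x y)
            _ _ _ _ _ Hf Hg).
  apply filterdiff_differentiable_pt_lim.
  refine (filterdiff_ext_lin _ _ _
            (filterdiff_mult (f x y, g x y) (fun P H => H) Rmult_comm) _).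
  intros [s t]; unfold plus, mult; simpl; ring.
Qed.

Lemma differentiable_pt_comp (g : R -> R) (f : R -> R -> R) (x y : R) :
  differentiable_pt f x y -> ex_derive g (f x y) ->
  differentiable_pt (fun s t => g (f s t)) x y.
Proof.
  intros [fx [fy Hf]] [l Hl].
  eexists; eexists.
  (* [g] is viewed as a function of two variables whose second partial derivative is 0, and [f]
     fills both slots. *)
  refine (differentiable_pt_lim_comp (fun a _ => g a) f f x y l 0
            _ _ _ _ _ Hf Hf).
  now apply differentiable_pt_lim_proj1_0, is_derive_Reals.
Qed.

Lemma differentiable_pt_fst (x y : R) : differentiable_pt (fun s _ => s) x y.
Proof.
  exists 1, 0; apply differentiable_pt_lim_proj1_0, derivable_pt_lim_id.
Qed.

Lemma differentiable_pt_snd (x y : R) : differentiable_pt (fun _ t => t) x y.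
Proof.
  exists 0, 1; intros e; exists e; intros s t _ _.
  replace (t - y - (0 * (s - x) + 1 * (t - y))) with 0 by ring.
  rewrite Rabs_R0.
  apply Rmult_le_pos; [apply Rlt_le, cond_pos | ].
  apply Rle_trans with (1 := Rabs_pos (s - x)), Rmax_l.
Qed.

Lemma differentiable_pt_const (c x y : R) :
  differentiable_pt (fun _ _ => c) x y.
Proof.
  exact (differentiable_pt_comp (fun _ => c) _ x y (differentiable_pt_fst x y)
           (ex_derive_const c x)).
Qed.

Lemma differentiable_pt_ex_derive (f : R -> R -> R) (x y : R) :
  differentiable_pt f x y ->
  ex_derive (fun s => f s y) x /\ ex_derive (fun t => f x t) y.
Proof.
  intros [lx [ly H]]; split.
  - exists (lx * 1 + ly * 0); apply is_derive_Reals.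
    refine (derivable_pt_lim_comp_2d f (fun s => s) (fun _ => y) x lx ly 1 0
              H _ _).
    + apply derivable_pt_lim_id.
    + apply derivable_pt_lim_const.
  - exists (lx * 0 + ly * 1); apply is_derive_Reals.
    refine (derivable_pt_lim_comp_2d f (fun _ => x) (fun t => t) y lx ly 0 1
              H _ _).
    + apply derivable_pt_lim_const.
    + apply derivable_pt_lim_id.
Qed.

Ltac solve_differentiable_pt :=
  repeat first
    [ assumption
    | apply differentiable_pt_const
    | apply differentiable_pt_plus
    | apply differentiable_pt_mult ].

(** * The minimal surface equation of a type 3 surface *)

Definition minimal_eqn (u v : R -> R) (x y : R) : Prop :=
  let p := Derive u x - y in
  let q := (v y - y * Derive v y) / 2 in
  (1 + p ^ 2) * (p + y / 2) * Derive (Derive v) y - p * q - Derive v y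
  - (1 + Derive v y ^ 2 + q ^ 2) * Derive (Derive u) x = 0.

(* [al], [be], [nu] are the components of a normal [N] in the left invariant
   frame, where the coordinate vectors of the surface are (0, 1, p) and
   (1, w, q). The quantity [T] is the trace of the shape operator, because the
   coordinate vectors have first components 0 and 1. *)
Lemma trace_shape_operator
    (p q w u2 v2 y al be nu alx bex nux aly bey nuy : R) :
  be + p * nu = 0 -> al + w * be + q * nu = 0 ->
  al ^ 2 + be ^ 2 + nu ^ 2 = 1 ->
  bex + p * nux + u2 * nu = 0 -> alx + w * bex + q * nux = 0 ->
  al * alx + be * bex + nu * nux = 0 ->
  bey + p * nuy - nu = 0 ->
  aly + w * bey + v2 * be + q * nuy - y * v2 / 2 * nu = 0 ->
  al * aly + be * bey + nu * nuy = 0 ->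
  let T := - (bex - p * al / 2) + w * (alx + (nu + p * be) / 2)
           - (aly + (w * nu + q * be) / 2) in
  nu <> 0 /\
  T * (1 + p ^ 2 + (q - p * w) ^ 2)
  = - nu * ((1 + p ^ 2) * (p + y / 2) * v2 - p * q - w
            - (1 + w ^ 2 + q ^ 2) * u2).
Proof.
  intros H1 H2 H3 X1 X2 X3 Y1 Y2 Y3 T.
  (* The normal is [nu] times [(- m, - p, 1)], so only [nu] and its derivatives [nux], [nuy] remain
     as unknowns. *)
  set (m := q - p * w).
  assert (be = - p * nu) by lra; subst be.
  assert (al = - m * nu) by (unfold m; nra); subst al.
  assert (bex = - p * nux - u2 * nu) by lra; subst bex.
  assert (alx = - m * nux + w * u2 * nu) by (unfold m; nra); subst alx.
  assert (bey = nu - p * nuy) by lra; subst bey.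
  assert (aly = - m * nuy - w * nu + v2 * p * nu + y * v2 / 2 * nu)
    by (unfold m; nra); subst aly.
  assert (Hnu : nu <> 0) by (intros ->; lra).
  split; trivial.
  (* The derivative of the unit length condition, freed of a factor [nu], determines [nux]; likewise
     for [nuy]. *)
  assert (Hx : nux * (1 + p ^ 2 + m ^ 2) = - u2 * nu * (p - m * w)).
  { apply Rmult_eq_reg_l with nu; trivial; unfold m in *; nra. }
  assert (Hy : nuy * (1 + p ^ 2 + m ^ 2)
               = nu * (p + m * (- w + v2 * p + y * v2 / 2))).
  { apply Rmult_eq_reg_l with nu; trivial; unfold m in *; nra. }
  unfold T.
  fold m.
  (* [T] is affine in [nux] and [nuy], with coefficients [p - m * w] and [m]; the factor in front
     lets [Hx] and [Hy] apply without division. *)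
  transitivity ((p - m * w) * (nux * (1 + p ^ 2 + m ^ 2))
                + m * (nuy * (1 + p ^ 2 + m ^ 2))
                + nu * (u2 - p * m / 2 + w ^ 2 * u2 + w * (1 - p ^ 2) / 2 + w / 2
                        + p * q / 2 - v2 * p - y * v2 / 2)
                  * (1 + p ^ 2 + m ^ 2)).
  - field.
  - rewrite Hx, Hy; unfold m; field.
Qed.

Ltac derive_from_hyps :=
  auto_derive;
  [ repeat split; eexists; eassumption
  | repeat match goal with
           | H : is_derive _ ?t ?l |- context [Derive ?g ?t] =>
               replace (Derive g t) with l
                 by (symmetry; exact (is_derive_unique _ _ _ H))
           end;
    field ].

(** The conditions on a unit normal hold on a whole interval and can be differentiated. A single
    variable serves both parameter directions: [X] and [Y] are the first two coordinates of the base
    point, [nu] is the vertical component in the left invariant frame. *)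
Lemma unit_normal_derivative (a b : Rbar) (n1 n2 n3 X Y p w q : R -> R)
    (t n1' n2' n3' X' Y' p' w' q' : R) :
  let nu s := n3 s + (Y s * n1 s - X s * n2 s) / 2 in
  let nu' := n3' + (Y' * n1 t + Y t * n1' - X' * n2 t - X t * n2') / 2 in
  is_derive n1 t n1' -> is_derive n2 t n2' -> is_derive n3 t n3' ->
  is_derive X t X' -> is_derive Y t Y' ->
  is_derive p t p' -> is_derive w t w' -> is_derive q t q' ->
  (forall s, in_itv a b s ->
     n2 s + p s * nu s = 0 /\ n1 s + w s * n2 s + q s * nu s = 0 /\
     n1 s ^ 2 + n2 s ^ 2 + nu s ^ 2 = 1) ->
  in_itv a b t ->
  n2' + p t * nu' + p' * nu t = 0 /\
  n1' + w t * n2' + w' * n2 t + q t * nu' + q' * nu t = 0 /\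
  n1 t * n1' + n2 t * n2' + nu t * nu' = 0.
Proof.
  intros nu nu' H1 H2 H3 HX HY Hp Hw Hq HN Ht.
  assert (Hnu : is_derive nu t nu').
  { unfold nu, nu'; derive_from_hyps. }
  clearbody nu nu'.
  repeat split.
  - apply (is_derive_in_itv_zero a b (fun s => n2 s + p s * nu s) 0 t);
      [intros s Hs; apply HN, Hs | exact Ht | ].
    derive_from_hyps.
  - apply (is_derive_in_itv_zero a b
             (fun s => n1 s + w s * n2 s + q s * nu s) 0 t);
      [intros s Hs; apply HN, Hs | exact Ht | ].
    derive_from_hyps.
  - assert (E : 2 * (n1 t * n1' + n2 t * n2' + nu t * nu') = 0); [ | lra].
    apply (is_derive_in_itv_zero a b
             (fun s => n1 s ^ 2 + n2 s ^ 2 + nu s ^ 2) 1 t);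
      [intros s Hs; apply HN, Hs | exact Ht | ].
    derive_from_hyps.
Qed.

Lemma type3_surface_eq (u v : R -> R) (x y : R) :
  type3_surface u v x y = (y, x + v y, u x - x * y / 2).
Proof.
  unfold type3_surface, translation_surface; simpl.
  apply f_equal2; [apply f_equal2 | ]; field.
Qed.

Section Type3.

Variables (xl xr yl yr : Rbar) (u v : R -> R).
Hypotheses (hu : smooth_on xl xr u) (hv : smooth_on yl yr v).

Lemma d1_type3_surface (x y : R) :
  in_itv xl xr x ->
  d1 (type3_surface u v) x y = (0, 1, Derive u x - y / 2).
Proof.
  intros Hx; unfold d1, of_coords, type3_surface, translation_surface; simpl.
  assert (Hu := smooth_on_is_derive _ _ _ _ hu Hx).
  apply f_equal2; [apply f_equal2 | ]; apply is_derive_unique; auto_derive;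
    try (now exists (Derive u x)); trivial;
    change (Derive (fun s => u s) x) with (Derive u x); field.
Qed.

Lemma d2_type3_surface (x y : R) :
  in_itv yl yr y ->
  d2 (type3_surface u v) x y = (1, Derive v y, - x / 2).
Proof.
  intros Hy; unfold d2, of_coords, type3_surface, translation_surface; simpl.
  assert (Hv := smooth_on_is_derive _ _ _ _ hv Hy).
  apply f_equal2; [apply f_equal2 | ]; apply is_derive_unique; auto_derive;
    try (now exists (Derive v y)); trivial;
    change (Derive (fun t => v t) y) with (Derive v y); field.
Qed.

Lemma immersed_type3_surface (x y : R) :
  in_itv xl xr x -> in_itv yl yr y -> immersed_at (type3_surface u v) x y.
Proof.
  intros Hx Hy s t.
  rewrite d1_type3_surface, d2_type3_surface by trivial.
  intros H; assert (H1 := H ax1); assert (H2 := H ax2); simpl in *.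
  assert (t = 0) by lra; subst t; lra.
Qed.

(** [nil_metric] is the Euclidean product of the frame components, the third of which is [nil_form];
    on [N] this form takes the value [nu]. *)
Lemma unit_normal_type3_surface (N : R -> R -> R3) (x y : R) :
  in_itv xl xr x -> in_itv yl yr y ->
  let al := coord ax1 (N x y) in
  let be := coord ax2 (N x y) in
  let nu := coord ax3 (N x y) + ((x + v y) * al - y * be) / 2 in
  let p := Derive u x - y in
  let q := (v y - y * Derive v y) / 2 in
  unit_normal_at nil_metric (type3_surface u v) N x y <->
  be + p * nu = 0 /\ al + Derive v y * be + q * nu = 0 /\
  al ^ 2 + be ^ 2 + nu ^ 2 = 1.
Proof.
  intros Hx Hy al be nu p q; unfold unit_normal_at.
  rewrite d1_type3_surface, d2_type3_surface by trivial.
  unfold nil_metric, nil_form; simpl; fold al be.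
  replace (0 + y) with y by ring.
  fold al be.
  assert (E : coord ax3 (N x y) = nu - ((x + v y) * al - y * be) / 2)
    by (unfold nu; ring).
  rewrite E.
  match goal with |- ?a = 0 /\ ?b = 0 /\ ?c = 1 <-> _ =>
    replace a with (be + p * nu) by (unfold p; field);
    replace b with (al + Derive v y * be + q * nu) by (unfold q; field);
    replace c with (al ^ 2 + be ^ 2 + nu ^ 2) by field
  end.
  reflexivity.
Qed.

(** In the left invariant frame the connection coefficients are 0 or plus or minus 1/2. There the
    covariant derivative has components [c1], [c2] and the derivative of [nu] minus [n ax1 / 2]; the
    last term of the third coordinate passes from the frame back to coordinates. *)
Lemma cov1_type3_surface (N : R -> R -> R3) (x y : R) (k : axis) :
  in_itv xl xr x ->
  let n i := coord i (N x y) in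
  let n' i := coord i (d1 N x y) in
  let nu := n ax3 + ((x + v y) * n ax1 - y * n ax2) / 2 in
  let p := Derive u x - y in
  let c1 := n' ax1 + (nu + p * n ax2) / 2 in
  let c2 := n' ax2 - p * n ax1 / 2 in
  coord k (cov1 nil_metric (type3_surface u v) N x y)
  = match k with
    | ax1 => c1
    | ax2 => c2
    | ax3 => n' ax3 + (n ax1 + (x + v y) * n' ax1 - y * n' ax2) / 2 - n ax1 / 2
             - ((x + v y) * c1 - y * c2) / 2
    end.
Proof.
  intros Hx n n' nu p c1 c2; unfold cov1, sum3, of_coords.
  rewrite d1_type3_surface, type3_surface_eq by trivial.
  rewrite !christoffel_nil_metric.
  unfold c1, c2, p, nu, n, n'; destruct k; simpl; field.
Qed.

Lemma cov2_type3_surface (N : R -> R -> R3) (x y : R) (k : axis) :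
  in_itv yl yr y ->
  let n i := coord i (N x y) in
  let n' i := coord i (d2 N x y) in
  let nu := n ax3 + ((x + v y) * n ax1 - y * n ax2) / 2 in
  let w := Derive v y in
  let q := (v y - y * w) / 2 in
  let c1 := n' ax1 + (w * nu + q * n ax2) / 2 in
  let c2 := n' ax2 - (nu + q * n ax1) / 2 in
  coord k (cov2 nil_metric (type3_surface u v) N x y)
  = match k with
    | ax1 => c1
    | ax2 => c2
    | ax3 => n' ax3
             + (w * n ax1 + (x + v y) * n' ax1 - n ax2 - y * n' ax2) / 2
             + (n ax2 - w * n ax1) / 2 - ((x + v y) * c1 - y * c2) / 2
    end.
Proof.
  intros Hy n n' nu w q c1 c2; unfold cov2, sum3, of_coords.
  rewrite d2_type3_surface, type3_surface_eq by trivial.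
  rewrite !christoffel_nil_metric.
  unfold c1, c2, q, w, nu, n, n'; destruct k; simpl; field.
Qed.

(** Valid for any differentiable unit normal, so that it applies both to a given normal and to a
    constructed one. Besides a trace, [is_mean_curvature] asks for a matrix: it exists because a
    field of constant length has covariant derivatives orthogonal to it, hence tangent to the
    surface. *)
Lemma mean_curvature_type3_surface (N : R -> R -> R3) :
  (forall x y, in_itv xl xr x -> in_itv yl yr y ->
     (forall k, differentiable_pt (fun s t => coord k (N s t)) x y) /\
     unit_normal_at nil_metric (type3_surface u v) N x y) ->
  forall x y, in_itv xl xr x -> in_itv yl yr y ->
    is_mean_curvature nil_metric (type3_surface u v) N x y 0 <->
    minimal_eqn u v x y.
Proof.
  intros HN x y Hx Hy.
  assert (Hu := smooth_on_is_derive _ _ _ _ hu Hx).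
  assert (Hv := smooth_on_is_derive _ _ _ _ hv Hy).
  assert (Hu2 := smooth_on_is_derive2 _ _ _ _ hu Hx).
  assert (Hv2 := smooth_on_is_derive2 _ _ _ _ hv Hy).
  assert (D1 : forall k, is_derive (fun s => coord k (N s y)) x
                                   (coord k (d1 N x y))).
  { intros k; destruct (HN x y Hx Hy) as [H _].
    specialize (H k); apply differentiable_pt_ex_derive in H as [H _].
    apply Derive_correct in H; destruct k; exact H. }
  assert (D2 : forall k, is_derive (fun t => coord k (N x t)) y
                                   (coord k (d2 N x y))).
  { intros k; destruct (HN x y Hx Hy) as [H _].
    specialize (H k); apply differentiable_pt_ex_derive in H as [_ H].
    apply Derive_correct in H; destruct k; exact H. }
  assert (HN' : forall s t, in_itv xl xr s -> in_itv yl yr t -> _) by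
    (intros s t Hs Ht;
     exact (proj1 (unit_normal_type3_surface N s t Hs Ht)
              (proj2 (HN s t Hs Ht)))).
  cbv zeta in HN'.
  destruct (HN' x y Hx Hy) as [H1 [H2 H3]].
  destruct (unit_normal_derivative xl xr _ _ _ (fun _ => y)
    (fun s => s + v y) (fun s => Derive u s - y) (fun _ => Derive v y)
    (fun _ => (v y - y * Derive v y) / 2) x _ _ _ 0 1 (Derive (Derive u) x) 0 0
    (D1 ax1) (D1 ax2) (D1 ax3)) as [X1 [X2 X3]]; trivial.
  { auto_derive; trivial. }
  { auto_derive; trivial; ring. }
  { revert Hu2; generalize (Derive (Derive u) x); intros; derive_from_hyps. }
  { auto_derive; trivial. }
  { auto_derive; trivial. }
  { intros s Hs; exact (HN' s y Hs Hy). }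
  destruct (unit_normal_derivative yl yr _ _ _ (fun t => t)
    (fun t => x + v t) (fun t => Derive u x - t) (Derive v)
    (fun t => (v t - t * Derive v t) / 2) y _ _ _ 1 (Derive v y) (- 1)
    (Derive (Derive v) y) (- y * Derive (Derive v) y / 2)
    (D2 ax1) (D2 ax2) (D2 ax3)) as [Y1 [Y2 Y3]]; trivial.
  { apply (is_derive_id y). }
  { revert Hv; generalize (Derive v y); intros; derive_from_hyps. }
  { auto_derive; trivial; ring. }
  { revert Hv Hv2; generalize (Derive (Derive v) y).
    intros; auto_derive.
    - repeat split; eexists; eassumption.
    - rewrite (is_derive_unique (fun t : R => Derive v t) y _ Hv2).
      change (Derive (fun t => v t) y) with (Derive v y); field. }
  { intros t Ht; exact (HN' x t Hx Ht). }
  clear HN HN' D1 D2 Hu Hv Hu2 Hv2.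
  assert (C1 := fun k => cov1_type3_surface N x y k Hx).
  assert (C2 := fun k => cov2_type3_surface N x y k Hy).
  unfold is_mean_curvature, is_shape_operator, minimal_eqn.
  rewrite d1_type3_surface, d2_type3_surface by trivial.
  assert (C11 := C1 ax1); assert (C12 := C1 ax2); assert (C13 := C1 ax3).
  assert (C21 := C2 ax1); assert (C22 := C2 ax2); assert (C23 := C2 ax3).
  cbv beta iota zeta in C11, C12, C13, C21, C22, C23; clear C1 C2.
  (* Replacing the covariant and partial derivatives by arbitrary reals reduces the rest to
     algebra. *)
  revert C11 C12 C13 C21 C22 C23.
  generalize (cov1 nil_metric (type3_surface u v) N x y)
    (cov2 nil_metric (type3_surface u v) N x y).
  intros c1 c2 C11 C12 C13 C21 C22 C23.
  remember ((x + v y) * coord ax1 (N x y) - y * coord ax2 (N x y)) as z eqn:Ez.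
  revert H1 H2 H3 X1 X2 X3 Y1 Y2 Y3 C11 C12 C13 C21 C22 C23 Ez; cbv zeta.
  generalize (Derive (Derive u) x) (Derive (Derive v) y)
    (coord ax1 (N x y)) (coord ax2 (N x y)) (coord ax3 (N x y))
    (coord ax1 (d1 N x y)) (coord ax2 (d1 N x y)) (coord ax3 (d1 N x y))
    (coord ax1 (d2 N x y)) (coord ax2 (d2 N x y)) (coord ax3 (d2 N x y)).
  intros u2 v2 al be n3 alx bex n3x aly bey n3y.
  replace (Derive u x - y / 2) with (Derive u x - y + y / 2) by field.
  remember ((v y - y * Derive v y) / 2) as q eqn:Eq.
  remember (Derive v y) as w eqn:Ew.
  remember (Derive u x - y) as p eqn:Ep.
  intros; remember (n3 + z / 2) as nu eqn:Enu.
  remember (n3x + (1 * al + (x + v y) * alx - 0 * be - y * bex) / 2)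
    as nux eqn:Enux.
  remember (n3y + (w * al + (x + v y) * aly - 1 * be - y * bey) / 2)
    as nuy eqn:Enuy.
  destruct (trace_shape_operator p q w u2 v2 y al be nu alx bex nux aly bey nuy)
    as [Hnu HT]; trivial; try lra.
  assert (W : 0 < 1 + p ^ 2 + (q - p * w) ^ 2).
  { assert (P := pow2_ge_0 p); assert (Q := pow2_ge_0 (q - p * w)); lra. }
  cbv zeta in HT.
  set (PDE := _ - _ - _ - _) in HT |- *.
  set (T := - (bex - p * al / 2) + _ - _) in HT.
  assert (ET : T = w * coord ax1 c1 - coord ax2 c1 - coord ax1 c2)
    by (rewrite C11, C12, C21; unfold T; field).
  assert (TP : T = 0 <-> PDE = 0).
  { split; intros E; rewrite E in HT.
    - destruct (Rmult_integral (- nu) PDE); lra.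
    - destruct (Rmult_integral T (1 + p ^ 2 + (q - p * w) ^ 2)); lra. }
  clearbody PDE T; clear HT; rewrite <- TP; clear TP; subst T.
  split.
  - intros [a11 [a12 [a21 [a22 [H E]]]]].
    destruct (H ax1) as [S11 S12]; destruct (H ax2) as [S21 S22].
    simpl coord in *; nra.
  - intros E.
    (* The coordinate vectors start with [(0, 1)] and [(1, w)], so the first two coordinates dictate
       the four entries; the third coordinate remains to be checked. *)
    exists (w * coord ax1 c1 - coord ax2 c1), (w * coord ax1 c2 - coord ax2 c2),
      (- coord ax1 c1), (- coord ax1 c2); split; [ | lra].
    (* Orthogonality of [N] to its covariant derivatives. Divided by [nu], it gives their vertical
       components, hence the third coordinates. *)
    assert (K1 : al * coord ax1 c1 + be * coord ax2 c1 + nu * (nux - al / 2) = 0).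
    { rewrite C11, C12; rewrite <- X3; field. }
    assert (K2 : al * coord ax1 c2 + be * coord ax2 c2
                 + nu * (nuy + (be - w * al) / 2) = 0).
    { rewrite C21, C22; rewrite <- Y3; field. }
    assert (Hbe : be = - p * nu) by lra.
    assert (Hal : al = - (q - p * w) * nu) by (rewrite Hbe in H2; lra).
    assert (K1' : nux - al / 2 = (q - p * w) * coord ax1 c1 + p * coord ax2 c1).
    { apply Rmult_eq_reg_l with nu; trivial.
      transitivity (- al * coord ax1 c1 - be * coord ax2 c1); [lra | ].
      rewrite Hal, Hbe; ring. }
    assert (K2' : nuy + (be - w * al) / 2
                  = (q - p * w) * coord ax1 c2 + p * coord ax2 c2).
    { apply Rmult_eq_reg_l with nu; trivial.
      transitivity (- al * coord ax1 c2 - be * coord ax2 c2); [lra | ].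
      rewrite Hal, Hbe; ring. }
    replace (n3x + (al + (x + v y) * alx - y * bex) / 2 - al / 2)
      with (nux - al / 2) in C13 by (rewrite Enux; field).
    replace (n3y + (w * al + (x + v y) * aly - be - y * bey) / 2
             + (be - w * al) / 2)
      with (nuy + (be - w * al) / 2) in C23 by (rewrite Enuy; field).
    rewrite <- C11, <- C12, K1' in C13; rewrite <- C21, <- C22, K2' in C23.
    intros k; split; destruct k;
      [ | | rewrite C13, Eq | | | rewrite C23, Eq ]; simpl coord; field.
Qed.

Lemma minimal_type3_surface :
  minimal nil_metric (type3_surface u v) xl xr yl yr <->
  (forall x y, in_itv xl xr x -> in_itv yl yr y -> minimal_eqn u v x y).
Proof.
  split.
  - intros [_ [N HN]] x y Hx Hy.
    apply (mean_curvature_type3_surface N); trivial.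
    + intros s t Hs Ht; destruct (HN s t Hs Ht) as [H1 [H2 _]]; now split.
    + apply HN; trivial.
  - intros H; split.
    { intros x y; apply immersed_type3_surface. }
    (* Subtraction and division are spelled with [+], [*] and constants, the forms that
       [solve_differentiable_pt] recognizes. *)
    set (p s t := Derive u s + (- 1) * t).
    set (q t := (v t + (- 1) * (t * Derive v t)) * / 2).
    set (m s t := q t + (- 1) * (p s t * Derive v t)).
    set (W s t := 1 + p s t * p s t + m s t * m s t).
    set (nu s t := / sqrt (W s t)).
    set (al s t := (- 1) * (m s t * nu s t)).
    set (be s t := (- 1) * (p s t * nu s t)).
    (* The third coordinate is chosen so that [nil_form] takes the value [nu] on [N]. *)
    set (N := fun s t => (al s t, be s t,
      nu s t + (- / 2) * ((s + v t) * al s t + (- 1) * (t * be s t))) : R3).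
    assert (HW : forall s t, 0 < W s t).
    { intros s t; unfold W.
      assert (P := Rle_0_sqr (p s t)); assert (Q := Rle_0_sqr (m s t)).
      unfold Rsqr in *; lra. }
    assert (HN : forall x y, in_itv xl xr x -> in_itv yl yr y ->
      (forall k, differentiable_pt (fun s t => coord k (N s t)) x y) /\
      unit_normal_at nil_metric (type3_surface u v) N x y).
    { intros x y Hx Hy; split.
      - assert (Hv : differentiable_pt (fun _ t => v t) x y).
        { apply (differentiable_pt_comp v (fun _ t => t)).
          apply differentiable_pt_snd.
          exact (ex_intro _ _ (smooth_on_is_derive _ _ _ _ hv Hy)). }
        assert (Hv' : differentiable_pt (fun _ t => Derive v t) x y).
        { apply (differentiable_pt_comp (Derive v) (fun _ t => t)).
          apply differentiable_pt_snd.
          exact (ex_intro _ _ (smooth_on_is_derive2 _ _ _ _ hv Hy)). }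
        assert (Hu' : differentiable_pt (fun s _ => Derive u s) x y).
        { apply (differentiable_pt_comp (Derive u) (fun s _ => s)).
          apply differentiable_pt_fst.
          exact (ex_intro _ _ (smooth_on_is_derive2 _ _ _ _ hu Hx)). }
        assert (Hs := differentiable_pt_fst x y).
        assert (Ht := differentiable_pt_snd x y).
        assert (Hp : differentiable_pt p x y) by solve_differentiable_pt.
        assert (Hq : differentiable_pt (fun _ t => q t) x y)
          by solve_differentiable_pt.
        assert (Hm : differentiable_pt m x y) by solve_differentiable_pt.
        assert (Hnu : differentiable_pt nu x y).
        { apply (differentiable_pt_comp (fun z => / sqrt z) W).
          - solve_differentiable_pt.
          - assert (H0 := HW x y); assert (H1 := sqrt_lt_R0 _ H0).
            auto_derive; repeat split; lra. }
        assert (Hal : differentiable_pt al x y) by solve_differentiable_pt.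
        assert (Hbe : differentiable_pt be x y) by solve_differentiable_pt.
        intros k; destruct k; [exact Hal | exact Hbe | ].
        simpl; solve_differentiable_pt.
      - apply unit_normal_type3_surface; trivial.
        assert (Hnu : nu x y ^ 2 * W x y = 1).
        { assert (H0 := HW x y); assert (H1 := sqrt_lt_R0 _ H0).
          unfold nu; rewrite <- (sqrt_sqrt (W x y)) at 2 by lra.
          field; lra. }
        simpl coord.
        replace (nu x y + - / 2 * ((x + v y) * al x y + -1 * (y * be x y))
                 + ((x + v y) * al x y - y * be x y) / 2)
          with (nu x y) by field.
        unfold al, be; repeat split.
        + unfold p; ring.
        + unfold m, p, q; field.
        + rewrite <- Hnu; unfold W; ring. }
    exists N; intros x y Hx Hy; destruct (HN x y Hx Hy) as [H1 H2].
    repeat split; try apply H1; try apply H2.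
    apply mean_curvature_type3_surface; auto.
Qed.

End Type3.

(** * Intermediate values and zeros of cubics *)

(** Only the values at [s] and [t] are ordered, not the points; for [t < s] the function [- f] is
    used. *)
Lemma intermediate_value (a b : Rbar) (f : R -> R) (s t z : R) :
  (forall r, in_itv a b r -> continuity_pt f r) ->
  in_itv a b s -> in_itv a b t -> f s <= z <= f t ->
  exists r, in_itv a b r /\ f r = z.
Proof.
  intros Hf Hs Ht Hz.
  destruct (Rtotal_order s t) as [H | [H | H]].
  - destruct (f_interv_is_interv f s t z H Hz) as [r [Hr E]].
    + intros r Hr; exact (Hf r (in_itv_between _ _ _ _ _ Hs Ht Hr)).
    + exists r; split; trivial; exact (in_itv_between _ _ _ _ _ Hs Ht Hr).
  - subst t; exists s; split; trivial; lra.
  - destruct (f_interv_is_interv (- f)%F t s (- z) H) as [r [Hr E]].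
    + unfold opp_fct; lra.
    + intros r Hr; apply continuity_pt_opp.
      exact (Hf r (in_itv_between _ _ _ _ _ Ht Hs Hr)).
    + exists r; split.
      * exact (in_itv_between _ _ _ _ _ Ht Hs Hr).
      * unfold opp_fct in E; lra.
Qed.

(** The third difference of four equally spaced values is [6 c3 d^3]; once [c3 = 0], the second
    difference is [2 c2 d^2], and so on down. Each is a linear combination of the hypotheses, within
    reach of [lra]. *)
Lemma cubic_zero (c0 c1 c2 c3 e d : R) :
  d <> 0 ->
  (forall k, k = 0 \/ k = 1 \/ k = 2 \/ k = 3 ->
     let s := e + k * d in c0 + c1 * s + c2 * s ^ 2 + c3 * s ^ 3 = 0) ->
  c0 = 0 /\ c1 = 0 /\ c2 = 0 /\ c3 = 0.
Proof.
  intros Hd H.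
  assert (H0 := H 0 ltac:(tauto)); assert (H1 := H 1 ltac:(tauto)).
  assert (H2 := H 2 ltac:(tauto)); assert (H3 := H 3 ltac:(tauto)).
  cbv zeta in H0, H1, H2, H3.
  assert (Hd2 : d ^ 2 <> 0) by now apply pow_nonzero.
  assert (Hd3 : d ^ 3 <> 0) by now apply pow_nonzero.
  assert (c3 = 0) by (apply Rmult_eq_reg_r with (d ^ 3); trivial; lra).
  subst c3.
  assert (c2 = 0) by (apply Rmult_eq_reg_r with (d ^ 2); trivial; lra).
  subst c2.
  assert (c1 = 0) by (apply Rmult_eq_reg_r with d; trivial; lra).
  subst c1; repeat split; lra.
Qed.

(** * Integration of the equation for affine u *)

(** With [s = a - t] the logarithm is arsinh [s], and [s sqrt (1 + s^2)] plus arsinh [s] has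
    derivative [2 sqrt (1 + s^2)]; the sign is that of [s' = - 1]. *)
Lemma is_derive_asinh_primitive (a y : R) :
  is_derive (fun t => (a - t) * sqrt (1 + (a - t) ^ 2)
                      + ln (a - t + sqrt (1 + (a - t) ^ 2))) y
    (- 2 * sqrt (1 + (a - y) ^ 2)).
Proof.
  assert (P : 0 < 1 + (a - y) ^ 2) by (assert (Q := pow2_ge_0 (a - y)); lra).
  assert (S := sqrt_lt_R0 _ P).
  assert (E : sqrt (1 + (a - y) ^ 2) ^ 2 = 1 + (a - y) ^ 2)
    by (apply pow2_sqrt; lra).
  assert (L : 0 < a - y + sqrt (1 + (a - y) ^ 2)).
  { destruct (Rlt_le_dec 0 (a - y)); [lra | nra]. }
  auto_derive.
  - repeat split; assumption.
  - change (1 + (a + - y) * ((a + - y) * 1)) with (1 + (a - y) ^ 2).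
    set (r := sqrt _) in *.
    transitivity (- r - (1 + (a - y) ^ 2) / r).
    + field; lra.
    + rewrite <- E; field; lra.
Qed.

Lemma is_derive_sqrt_1_sqr (a y : R) :
  is_derive (fun t => sqrt (1 + (a - t) ^ 2)) y
    (- (a - y) / sqrt (1 + (a - y) ^ 2)).
Proof.
  assert (P : 0 < 1 + (a - y) ^ 2) by (assert (Q := pow2_ge_0 (a - y)); lra).
  assert (S := sqrt_lt_R0 _ P).
  auto_derive.
  - exact P.
  - change (1 + (a + - y) * ((a + - y) * 1)) with (1 + (a - y) ^ 2).
    field; lra.
Qed.

(* With [f y = (2 a - y) * v y] the equation reads
   [(1 + (a - y) ^ 2) * f'' + (a - y) * f' = 0], that is,
   [f' / sqrt (1 + (a - y) ^ 2)] is constant; no division by [2 a - y]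
   is needed. *)
Lemma affine_case_solutions (yl yr : Rbar) (v : R -> R) (a : R) :
  smooth_on yl yr v ->
  (forall y, in_itv yl yr y ->
     (1 + (a - y) ^ 2) * (a - y + y / 2) * Derive (Derive v) y
     - (a - y) * ((v y - y * Derive v y) / 2) - Derive v y = 0) <->
  exists b c, forall y, in_itv yl yr y ->
    (2 * a - y) * v y
    = b + c / 2 * ((a - y) * sqrt (1 + (a - y) ^ 2)
                   + ln (a - y + sqrt (1 + (a - y) ^ 2))).
Proof.
  intros hv.
  assert (S0 : forall y, 0 < sqrt (1 + (a - y) ^ 2)).
  { intros y; apply sqrt_lt_R0; assert (Q := pow2_ge_0 (a - y)); lra. }
  assert (S2 : forall y, 1 + (a - y) ^ 2 = sqrt (1 + (a - y) ^ 2) ^ 2).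
  { intros y; symmetry; apply pow2_sqrt; assert (Q := pow2_ge_0 (a - y)); lra. }
  assert (D1 : forall y, in_itv yl yr y ->
    is_derive (fun t => (2 * a - t) * v t) y ((2 * a - y) * Derive v y - v y)).
  { intros y Hy; assert (Hv := smooth_on_is_derive _ _ _ _ hv Hy).
    revert Hv; generalize (Derive v y); intros; derive_from_hyps. }
  assert (D2 : forall y, in_itv yl yr y ->
    is_derive (fun t => (2 * a - t) * Derive v t - v t) y
      ((2 * a - y) * Derive (Derive v) y - 2 * Derive v y)).
  { intros y Hy; assert (Hv := smooth_on_is_derive _ _ _ _ hv Hy).
    assert (Hv2 := smooth_on_is_derive2 _ _ _ _ hv Hy).
    revert Hv Hv2; generalize (Derive (Derive v) y); intros v2 Hv Hv2.
    auto_derive.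
    - repeat split; eexists; eassumption.
    - rewrite (is_derive_unique (fun t : R => Derive v t) y _ Hv2).
      change (Derive (fun t => v t) y) with (Derive v y); ring. }
  (* Since [2 (a - y + y / 2) = 2 a - y], twice the equation is the one for [f]. *)
  assert (K : forall y,
    ((2 * a - y) * Derive (Derive v) y - 2 * Derive v y) * (1 + (a - y) ^ 2)
    + ((2 * a - y) * Derive v y - v y) * (a - y)
    = 2 * ((1 + (a - y) ^ 2) * (a - y + y / 2) * Derive (Derive v) y
           - (a - y) * ((v y - y * Derive v y) / 2) - Derive v y))
    by (intros; field).
  split.
  - intros H.
    destruct (is_derive_zero_const yl yr
      (fun t => ((2 * a - t) * Derive v t - v t) / sqrt (1 + (a - t) ^ 2)))
      as [c Hc].
    { intros y Hy.
      (* The right side has the shape of the quotient rule; times the cube of the root it is the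
         left side of [K]. *)
      assert (E : 0 = (((2 * a - y) * Derive (Derive v) y - 2 * Derive v y)
                       * sqrt (1 + (a - y) ^ 2)
                       - ((2 * a - y) * Derive v y - v y)
                         * (- (a - y) / sqrt (1 + (a - y) ^ 2)))
                      / sqrt (1 + (a - y) ^ 2) ^ 2).
      { specialize (H y Hy); specialize (K y); specialize (S0 y).
        rewrite H, S2 in K; apply Rmult_eq_reg_r
          with (sqrt (1 + (a - y) ^ 2) ^ 3); [ | apply pow_nonzero; lra].
        rewrite Rmult_0_l, <- (Rmult_0_r 2), <- K; field; lra. }
      rewrite E.
      apply (is_derive_div (fun t => (2 * a - t) * Derive v t - v t)
               (fun t => sqrt (1 + (a - t) ^ 2))).
      - exact (D2 y Hy).
      - apply is_derive_sqrt_1_sqr.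
      - specialize (S0 y); lra. }
    destruct (is_derive_zero_const yl yr
      (fun t => (2 * a - t) * v t
                + c / 2 * ((a - t) * sqrt (1 + (a - t) ^ 2)
                           + ln (a - t + sqrt (1 + (a - t) ^ 2)))))
      as [b Hb].
    { intros y Hy.
      assert (E : 0 = (2 * a - y) * Derive v y - v y
                      + c / 2 * (- 2 * sqrt (1 + (a - y) ^ 2))).
      { rewrite <- (Hc y Hy); field; specialize (S0 y); lra. }
      rewrite E; apply (is_derive_plus (fun t => (2 * a - t) * v t)).
      - exact (D1 y Hy).
      - apply (is_derive_scal _ _ (c / 2)), is_derive_asinh_primitive. }
    (* The primitive decreases with derivative [- 2 sqrt (1 + (a - y) ^ 2)], hence the change of
       sign. *)
    exists b, (- c); intros y Hy; specialize (Hb y Hy); cbv beta in Hb; lra.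
  - intros [b [c H]] y Hy.
    assert (E1 : forall t, in_itv yl yr t ->
      (2 * a - t) * Derive v t - v t = - c * sqrt (1 + (a - t) ^ 2)).
    { intros t Ht.
      rewrite <- (is_derive_unique _ _ _ (D1 t Ht)).
      apply is_derive_unique.
      apply (is_derive_in_itv_ext yl yr (fun t => b + c / 2 *
        ((a - t) * sqrt (1 + (a - t) ^ 2)
         + ln (a - t + sqrt (1 + (a - t) ^ 2))))); trivial.
      { intros r Hr; symmetry; exact (H r Hr). }
      replace (- c * sqrt (1 + (a - t) ^ 2))
        with (0 + c / 2 * (- 2 * sqrt (1 + (a - t) ^ 2))) by field.
      apply (is_derive_plus (fun _ => b)).
      - auto_derive; trivial.
      - apply (is_derive_scal _ _ (c / 2)), is_derive_asinh_primitive. }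
    assert (E2 : (2 * a - y) * Derive (Derive v) y - 2 * Derive v y
                 = - c * (- (a - y) / sqrt (1 + (a - y) ^ 2))).
    { rewrite <- (is_derive_unique _ _ _ (D2 y Hy)).
      apply is_derive_unique.
      apply (is_derive_in_itv_ext yl yr
               (fun t => - c * sqrt (1 + (a - t) ^ 2))); trivial.
      { intros r Hr; symmetry; exact (E1 r Hr). }
      apply (is_derive_scal _ _ (- c)), is_derive_sqrt_1_sqr. }
    specialize (K y); specialize (S0 y).
    rewrite S2, E2, (E1 y Hy) in K.
    apply Rmult_eq_reg_l with 2; [ | lra].
    rewrite S2, <- K, Rmult_0_r; field; lra.
Qed.

(** A nonzero difference at [x] would persist at nearby points of the interval. This carries an
    identity across the single point [2 a]. *)
Lemma eq_on_in_itv_by_continuity (a b : Rbar) (f g : R -> R) (x : R) :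
  continuity_pt f x -> continuity_pt g x -> in_itv a b x ->
  (forall t, in_itv a b t -> t <> x -> f t = g t) -> f x = g x.
Proof.
  intros Hf Hg Hx H.
  destruct (Req_dec (f x - g x) 0) as [E | E]; [lra | exfalso].
  assert (Hh : continuity_pt (fun t => f t - g t) x)
    by exact (continuity_pt_minus f g x Hf Hg).
  apply continuity_pt_filterlim in Hh.
  assert (L : locally x (fun t => f t - g t <> 0)).
  { exact (Hh (fun z => z <> 0) (open_neq 0 _ E)). }
  destruct (filter_and _ _ L (in_itv_locally _ _ _ Hx)) as [e He].
  assert (He0 := cond_pos e).
  destruct (He (x + e / 2)) as [H1 H2].
  { unfold ball; simpl; unfold AbsRing_ball, abs, minus, plus, opp; simpl.
    rewrite Rabs_pos_eq; lra. }
  apply H1; rewrite H; trivial; lra.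
Qed.

(** * Rigidity of v for non-affine u *)

(* [c0 + c1 s + c2 s^2 + c3 s^3 = D u''] is the equation as a cubic in [s = u'];
   eliminating [u''] between the parameters [y] and [z] gives a cubic with four
   distinct zeros, provided by the intermediate value theorem. *)
Lemma nonaffine_case (xl xr yl yr : Rbar) (u v : R -> R) (x1 x2 : R) :
  smooth_on xl xr u -> smooth_on yl yr v ->
  (forall x y, in_itv xl xr x -> in_itv yl yr y -> minimal_eqn u v x y) ->
  in_itv xl xr x1 -> in_itv xl xr x2 -> Derive u x1 < Derive u x2 ->
  forall y, in_itv yl yr y ->
    Derive (Derive v) y = 0 /\ v y - y * Derive v y = 0.
Proof.
  intros hu hv H H1 H2 Hlt.
  set (q y := (v y - y * Derive v y) / 2).
  set (D y := 1 + Derive v y ^ 2 + q y ^ 2).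
  assert (HD : forall y, 0 < D y).
  { intros y; assert (P := pow2_ge_0 (Derive v y)).
    assert (Q := pow2_ge_0 (q y)); unfold D; lra. }
  (* Coefficients obtained by expanding with [p = s - y]. *)
  set (c0 y := - (1 + y ^ 2) * y / 2 * Derive (Derive v) y + y * q y
               - Derive v y).
  set (c1 y := (1 + 2 * y ^ 2) * Derive (Derive v) y - q y).
  set (c2 y := - (5 / 2) * y * Derive (Derive v) y).
  set (c3 y := Derive (Derive v) y).
  assert (P : forall y z, in_itv yl yr y -> in_itv yl yr z ->
    D z * c0 y - D y * c0 z = 0 /\ D z * c1 y - D y * c1 z = 0 /\
    D z * c2 y - D y * c2 z = 0 /\ D z * c3 y - D y * c3 z = 0).
  { intros y z Hy Hz.
    (* Four equally spaced values from [u' x1] to [u' x2], hence the step of one third. *)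
    apply (cubic_zero _ _ _ _ (Derive u x1) ((Derive u x2 - Derive u x1) / 3));
      [lra | intros k Hk s].
    destruct (intermediate_value xl xr (Derive u) x1 x2 s) as [x [Hx E]];
      trivial.
    { intros r Hr; apply derivable_continuous_pt.
      exists (Derive (Derive u) r); apply is_derive_Reals.
      exact (smooth_on_is_derive2 _ _ _ _ hu Hr). }
    { unfold s; split; destruct Hk as [-> | [-> | [-> | ->]]]; lra. }
    assert (Ey := H x y Hx Hy); assert (Ez := H x z Hx Hz).
    unfold minimal_eqn in Ey, Ez; rewrite E in Ey, Ez.
    cbv zeta in Ey, Ez; fold (q y) (q z) in Ey, Ez.
    fold (D y) in Ey; fold (D z) in Ez.
    transitivity (D z * (c0 y + c1 y * s + c2 y * s ^ 2 + c3 y * s ^ 3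
                         - D y * Derive (Derive u) x)
                  - D y * (c0 z + c1 z * s + c2 z * s ^ 2 + c3 z * s ^ 3
                           - D z * Derive (Derive u) x)); [ring | ].
    match type of Ey with ?l = 0 =>
      replace (_ - D y * Derive (Derive u) x) with l
        by (unfold c0, c1, c2, c3; field) end.
    match type of Ez with ?l = 0 =>
      replace (_ - D z * Derive (Derive u) x) with l
        by (unfold c0, c1, c2, c3; field) end.
    rewrite Ey, Ez; ring. }
  assert (V : forall y, in_itv yl yr y -> Derive (Derive v) y = 0).
  { intros y Hy; destruct (in_itv_other _ _ _ Hy) as [z [Hz Hne]].
    destruct (P y z Hy Hz) as [_ [_ [P2 P3]]].
    (* As [c2 y = - (5 / 2) y c3 y], the relations for [c2] and [c3] combine so that [v'' z]
       cancels. *)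
    assert (E : D z * Derive (Derive v) y * (z - y) = 0).
    { unfold c2, c3 in P2, P3.
      transitivity (2 / 5 * (D z * (- (5 / 2) * y * Derive (Derive v) y) -
                      D y * (- (5 / 2) * z * Derive (Derive v) z))
         + z * (D z * Derive (Derive v) y - D y * Derive (Derive v) z));
        [field | rewrite P2, P3; ring]. }
    specialize (HD z).
    apply Rmult_integral in E as [E | E]; [ | lra].
    apply Rmult_integral in E as [E | E]; lra. }
  assert (DV : forall y, in_itv yl yr y -> is_derive (Derive v) y 0).
  { intros y Hy; rewrite <- (V y Hy).
    exact (smooth_on_is_derive2 _ _ _ _ hv Hy). }
  assert (DQ : forall y, in_itv yl yr y ->
            is_derive (fun t => v t - t * Derive v t) y 0).
  { intros y Hy; specialize (DV y Hy).
    assert (Hv := smooth_on_is_derive _ _ _ _ hv Hy).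
    auto_derive.
    - repeat split; eexists; eassumption.
    - rewrite (is_derive_unique (fun t : R => Derive v t) y _ DV).
      change (Derive (fun t => v t) y) with (Derive v y); ring. }
  destruct (is_derive_zero_const _ _ _ DV) as [w Hw].
  destruct (is_derive_zero_const _ _ _ DQ) as [c Hc].
  intros y Hy; split; [exact (V y Hy) | ].
  destruct (in_itv_other _ _ _ Hy) as [z [Hz Hne]].
  destruct (P y z Hy Hz) as [P0 _].
  cbv beta in Hc.
  unfold c0, D, q in P0.
  rewrite (V y Hy), (V z Hz), (Hc y Hy), (Hc z Hz), (Hw y Hy), (Hw z Hz) in P0.
  rewrite (Hc y Hy).
  (* With [v' = w] and [v - y v' = c], [D] is the same positive constant at [y] and [z], and
     [c0 y - c0 z] is [(y - z) c / 2]. *)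
  assert (E : (1 + w ^ 2 + (c / 2) ^ 2) * ((y - z) * (c / 2)) = 0)
    by (rewrite <- P0; field).
  assert (Pw := pow2_ge_0 w); assert (Pc := pow2_ge_0 (c / 2)).
  apply Rmult_integral in E as [E | E]; [lra | ].
  apply Rmult_integral in E as [E | E]; lra.
Qed.

(** * The two families and their minimality *)

Theorem theorem3p8 (xl xr yl yr : Rbar) (u v : R -> R)
    (hx : Rbar_lt xl xr) (hy : Rbar_lt yl yr)
    (hu : smooth_on xl xr u) (hv : smooth_on yl yr v) :
  (forall x y : R, type3_surface u v x y = (y, x + v y, u x - x * y / 2)) /\
  (minimal nil_metric (type3_surface u v) xl xr yl yr ->
     (exists a b c d : R,
        (forall x, in_itv xl xr x ->
           u x = a / (2 * (1 + a ^ 2)) * x ^ 2 + b * x + c) /\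
        (forall y, in_itv yl yr y -> v y = - a * y + d)) \/
     (exists a b c u0 : R,
        (forall x, in_itv xl xr x -> u x = a * x + u0) /\
        (forall y, in_itv yl yr y -> y <> 2 * a ->
           v y = b / (2 * a - y)
                 + c / (2 * (2 * a - y))
                   * ((a - y) * sqrt (1 + (a - y) ^ 2)
                      + ln (a - y + sqrt (1 + (a - y) ^ 2)))))) /\
  (forall a b c : R,
     (forall x, in_itv xl xr x ->
        u x = a / (2 * (1 + a ^ 2)) * x ^ 2 + b * x + c) ->
     (forall y, in_itv yl yr y -> v y = - a * y) ->
     minimal nil_metric (type3_surface u v) xl xr yl yr) /\
  (forall a b c u0 : R,
     (forall x, in_itv xl xr x -> u x = a * x + u0) ->
     (forall y, in_itv yl yr y -> y <> 2 * a ->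
        v y = b / (2 * a - y)
              + c / (2 * (2 * a - y))
                * ((a - y) * sqrt (1 + (a - y) ^ 2)
                   + ln (a - y + sqrt (1 + (a - y) ^ 2)))) ->
     minimal nil_metric (type3_surface u v) xl xr yl yr).
Proof.
  split; [apply type3_surface_eq | ].
  assert (M := minimal_type3_surface xl xr yl yr u v hu hv).
  split; [ | split].
  - intros Hm; assert (H := proj1 M Hm).
    destruct (classic (exists x1 x2, in_itv xl xr x1 /\ in_itv xl xr x2 /\
                         Derive u x1 < Derive u x2))
      as [[x1 [x2 [H1 [H2 Hlt]]]] | Hu'].
    + left.
      assert (V := nonaffine_case _ _ _ _ u v x1 x2 hu hv H H1 H2 Hlt).
      destruct (is_derive_zero_const yl yr (Derive v)) as [w Hw].
      { intros y Hy; rewrite <- (proj1 (V y Hy)).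
        exact (smooth_on_is_derive2 _ _ _ _ hv Hy). }
      assert (Pw := pow2_ge_0 w).
      (* One parameter [y0] is enough: with [v'' = 0] and [q = 0] the equation reads
         [- w - (1 + w^2) u'' = 0]. *)
      destruct (in_itv_nonempty yl yr hy) as [y0 Hy0].
      assert (U : forall x, in_itv xl xr x ->
                    Derive (Derive u) x = - w / (1 + w ^ 2)).
      { intros x Hx; assert (E := H x y0 Hx Hy0); unfold minimal_eqn in E.
        destruct (V y0 Hy0) as [V1 V2]; rewrite V1, V2, (Hw y0 Hy0) in E.
        apply Rmult_eq_reg_r with (1 + w ^ 2); [ | lra].
        transitivity (- w); [ | field; lra].
        cbv zeta in E; lra. }
      destruct (is_derive_zero_const xl xr
                  (fun x => Derive u x - - w / (1 + w ^ 2) * x)) as [b Hb].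
      { intros x Hx; assert (D := smooth_on_is_derive2 _ _ _ _ hu Hx).
        rewrite (U x Hx) in D; auto_derive.
        - repeat split; eexists; eassumption.
        - rewrite (is_derive_unique (fun t : R => Derive u t) x _ D); field; lra. }
      destruct (is_derive_zero_const xl xr
                  (fun x => u x - (- w / (2 * (1 + w ^ 2)) * x ^ 2 + b * x)))
        as [c Hc].
      { intros x Hx; assert (D := smooth_on_is_derive _ _ _ _ hu Hx).
        replace (Derive u x) with (- w / (1 + w ^ 2) * x + b) in D
          by (specialize (Hb x Hx); cbv beta in Hb; lra).
        auto_derive.
        - repeat split; eexists; eassumption.
        - rewrite (is_derive_unique (fun t : R => u t) x _ D); field; lra. }
      (* The slope of [v] is [- a], so [a = - w]; the intercept is [v - y v' = 0]. *)
      exists (- w), b, c, 0; split.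
      * intros x Hx; specialize (Hc x Hx); cbv beta in Hc.
        replace ((- w) ^ 2) with (w ^ 2) by ring; lra.
      * intros y Hy; destruct (V y Hy) as [_ V2]; rewrite (Hw y Hy) in V2; lra.
    + right.
      destruct (in_itv_nonempty xl xr hx) as [x0 Hx0].
      set (a := Derive u x0).
      assert (U1 : forall x, in_itv xl xr x -> Derive u x = a).
      { intros x Hx; unfold a.
        destruct (Rtotal_order (Derive u x) (Derive u x0)) as [L | [L | L]];
          trivial; exfalso; apply Hu'; eauto. }
      assert (U2 : forall x, in_itv xl xr x -> Derive (Derive u) x = 0).
      { intros x Hx; apply (is_derive_in_itv_zero xl xr (Derive u) a x);
          trivial.
        exact (smooth_on_is_derive2 _ _ _ _ hu Hx). }
      destruct (is_derive_zero_const xl xr (fun x => u x - a * x)) as [u0 Hu0].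
      { intros x Hx; assert (D := smooth_on_is_derive _ _ _ _ hu Hx).
        rewrite (U1 x Hx) in D; derive_from_hyps. }
      destruct (proj1 (affine_case_solutions yl yr v a hv)) as [b [c Hv]].
      { intros y Hy; assert (E := H x0 y Hx0 Hy); unfold minimal_eqn in E.
        rewrite (U2 x0 Hx0) in E; fold a in E; cbv zeta in E; lra. }
      exists a, b, c, u0; split.
      * intros x Hx; specialize (Hu0 x Hx); cbv beta in Hu0; lra.
      * intros y Hy Hne; apply Rmult_eq_reg_l with (2 * a - y); [ | lra].
        rewrite (Hv y Hy); field; lra.
  - intros a b c Hu Hv; apply M; intros x y Hx Hy.
    assert (Pa := pow2_ge_0 a).
    assert (V1 : forall t, in_itv yl yr t -> Derive v t = - a).
    { intros t Ht; apply (Derive_in_itv_ext _ _ _ _ _ _ Hv Ht).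
      auto_derive; trivial; ring. }
    assert (V2 : Derive (Derive v) y = 0).
    { apply (Derive_in_itv_ext _ _ _ _ _ _ V1 Hy); auto_derive; trivial. }
    assert (U1 : forall t, in_itv xl xr t ->
                   Derive u t = a / (1 + a ^ 2) * t + b).
    { intros t Ht; apply (Derive_in_itv_ext _ _ _ _ _ _ Hu Ht).
      auto_derive; trivial; field; lra. }
    assert (U2 : Derive (Derive u) x = a / (1 + a ^ 2)).
    { apply (Derive_in_itv_ext _ _ _ _ _ _ U1 Hx).
      auto_derive; trivial; field; lra. }
    unfold minimal_eqn; rewrite U2, V2, (V1 y Hy), (Hv y Hy); field; lra.
  - intros a b c u0 Hu Hv; apply M; intros x y Hx Hy.
    assert (U1 : forall t, in_itv xl xr t -> Derive u t = a).
    { intros t Ht; apply (Derive_in_itv_ext _ _ _ _ _ _ Hu Ht).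
      auto_derive; trivial; ring. }
    assert (U2 : Derive (Derive u) x = 0).
    { apply (Derive_in_itv_ext _ _ _ _ _ _ U1 Hx); auto_derive; trivial. }
    unfold minimal_eqn; rewrite U2, (U1 x Hx); cbv zeta.
    rewrite Rmult_0_r, Rminus_0_r; revert y Hy.
    apply (affine_case_solutions yl yr v a hv); exists b, c.
    set (f := fun t => (2 * a - t) * v t).
    set (g := fun t => b + c / 2 * ((a - t) * sqrt (1 + (a - t) ^ 2)
                        + ln (a - t + sqrt (1 + (a - t) ^ 2)))).
    assert (E : forall t, in_itv yl yr t -> t <> 2 * a -> f t = g t).
    { intros t Ht Hne; unfold f, g; rewrite (Hv t Ht Hne); field; lra. }
    intros y Hy; change (f y = g y).
    (* At [2 a] the closed form says nothing about [v], but [f] and [g] are continuous there and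
       agree elsewhere on the interval. *)
    destruct (Req_dec y (2 * a)) as [-> | Hne]; [ | now apply E].
    apply (eq_on_in_itv_by_continuity yl yr); trivial;
      apply derivable_continuous_pt.
    + assert (D := smooth_on_is_derive _ _ _ _ hv Hy).
      apply ex_derive_Reals_0; unfold f; auto_derive.
      repeat split; eexists; eassumption.
    + apply ex_derive_Reals_0; unfold g.
      apply @ex_derive_plus; [apply ex_derive_const | ].
      apply ex_derive_scal.
      eexists; apply is_derive_asinh_primitive.
Qed.
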